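(* Let $M$ and $N$ be two atomized semilattices over finite sets of constants $C_M$ and $C_N$ respectively, with $C_M\cap C_N=\{c_1,\dots,c_h\}\neq\emptyset$. Let $c'_1,\dots,c'_h$ be new distinct constants, let $C'_N$ be obtained from $C_N$ by replacing each $c_i$ by $c'_i$ (so $C_M\cap C'_N=\emptyset$), and let $N'$ be the correspondingly renamed model over $C'_N$. Let $\square_E=\square_{Ec_1}\square_{Ec_2}\cdots\square_{Ec_h}$, where $\square_{Ec_i}=\square_{c_i\le c'_i}\square_{c'_i\le c_i}$. Then: (i) $M\oplus N\cong\square_E(M+N')$. (ii) $M\oplus N=\big(\square_E(M+N')\big)^{|(C_M\cup C_N)}$. (iii) Every atom of $M\oplus N$ is an atom of $M+N$ or redundant with $M+N$. (iv) $M+N$ is freer or as free as $M\oplus N$. (v) There is a homomorphism from $M+N$ onto $M\oplus N$. (vi) $M\oplus N=\square_{r_1}\square_{r_2}\cdots\square_{r_k}(M+N)$ for some duples $r_1,\dots,r_k$ over $C_M\cup C_N$.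
   Context: A semilattice is a nonempty set with a commutative, associative, idempotent operation $\odot$, ordered by $a\le b$ iff $a\odot b=b$. For a finite set $C$ of constants, $F_C(\emptyset)$ is the free semilattice on $C$; its elements (terms) $t$ are identified with their nonempty sets $\mathbf{C}(t)\subseteq C$ of component constants. A model over $C$ is a semilattice $M$ with a map $C\to M$ whose image generates $M$; it induces the natural homomorphism $\nu_M:F_C(\emptyset)\to M$. A duple over $C$ is an ordered pair $r=(r_L,r_R)$ of terms over $C$; $M\models r^+$ means $\nu_M(r_L)\le\nu_M(r_R)$, and $M\models r^-$ means the negation. Models over the same $C$ are regarded as equal if they satisfy the same positive duples. For models $K,L$ over $C$, $K$ is freer or as free as $L$ if $L\models r^-$ implies $K\models r^-$ for all duples $r$ over $C$. For $Q\subseteq C$, $M^{|Q}$ is the subalgebra of $M$ generated by $Q$, viewed as a model over $Q$. An atom $\phi$ over $C$ is determined by a nonempty subset $\mathbf{U}^c(\phi)\subseteq C$; $\phi<t$ means $\mathbf{C}(t)\cap\mathbf{U}^c(\phi)\ne\emptyset$. A set $A$ of atoms over $C$ atomizes $M$ ($M=[A]$) if every $c\in C$ satisfies $\phi<c$ for some $\phi\in A$, and for all terms $t,s$: $\nu_M(t)\le\nu_M(s)$ iff there is no $\phi\in A$ with $\phi<t$, $\phi\not<s$. An atom is in (is an atom of) $M$ if it belongs to some set of atoms atomizing $M$. An atom $\phi$ is redundant with $M$ if for each $c$ with $\phi<c$ there is $\eta$ in $M$ with $\eta<c$ and $\mathbf{U}^c(\eta)\subsetneq\mathbf{U}^c(\phi)$.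 Union model: if $M=[A]$ over $C_M$ and $N=[B]$ over $C_N$, $M+N$ is the model $[A\cup B]$ over $C_M\cup C_N$ (it does not depend on the choice of $A,B$). Full crossing: for a duple $r=(r_L,r_R)$ and $M=[A]$, put $H=\{\phi\in A:\phi<r_L,\phi\not<r_R\}$ and $B=\{\phi\in A:\phi<r_R\}$; $\square_rM=\square_{r_L\le r_R}M$ is the model atomized by $(A\setminus H)\cup\{\lambda\bigtriangledown\rho:\lambda\in H,\rho\in B\}$, where $\mathbf{U}^c(\lambda\bigtriangledown\rho)=\mathbf{U}^c(\lambda)\cup\mathbf{U}^c(\rho)$ (as a model it does not depend on $A$). Join model: if $C_M\cap C_N=\emptyset$, $M\oplus N$ is the freest model over $C_M\cup C_N$ (the one satisfying the fewest positive duples) such that the maps $M\to M\oplus N$ and $N\to M\oplus N$ sending each constant to the constant of the same name are well-defined injective homomorphisms. If $C_M\cap C_N\ne\emptyset$, with $N'$ the renamed copy of $N$ over $C'_N$ as in the claim, $M\oplus N$ is the quotient $(M\oplus N')/\theta$, where $\theta$ is the smallest congruence identifying $c_i$ with $c'_i$ for all $i$, viewed as a model over $C_M\cup C_N$ (the constants $c'_i$ being renamed back to $c_i$). *)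

(* Defs.v *)
From HB Require Import structures.
From mathcomp Require Import all_boot all_order.

Set Implicit Arguments.
Unset Strict Implicit.
Unset Printing Implicit Defensive.

Import Order.TTheory Order.DefaultSetSubsetOrder.
Local Open Scope order_scope.

(* Constants are elements of an ambient finite type T, so that constant sets
   of different models can be compared, united and intersected. Terms over C
   (elements of the free semilattice on C) and atoms over C are both given by
   a nonempty subset of C. *)
Definition over (T : finType) (C U : {set T}) : bool :=
  (U != set0) && (U \subset C).

Notation cst C := {c | c \in C}.
Notation term C := {t : {set _} | over C t}.
Notation duple C := (term C * term C)%type.

(* phi < t, for the atom with upper constants phi and the term with component
   constants t. *)
Definition below (T : finType) (phi t : {set T}) : bool := phi :&: t != set0.

Lemma term_has_cst (T : finType) (C : {set T}) (t : term C) :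
  exists c : cst C, val c \in val t.
Proof.
case: t => t /= /andP[/set0Pn[c ct] /subsetP tC].
by exists (exist _ c (tC _ ct)).
Qed.

Definition some_cst (T : finType) (C : {set T}) (t : term C) : cst C :=
  xchoose (term_has_cst t).

(* The join of f over the component constants of t, i.e. the value at t of the
   unique homomorphism from the free semilattice on C extending f. As a
   semilattice has no least element in general, the iteration starts from the
   image of some constant of t, which changes nothing by idempotence. *)
Definition nu (T : finType) (C : {set T}) d (L : joinSemilatticeType d)
    (f : cst C -> L) (t : term C) : L :=
  \big[Order.join/f (some_cst t)]_(c : cst C | val c \in val t) f c.

Lemma nu_le (T : finType) (C : {set T}) d (L : joinSemilatticeType d)
    (f : cst C -> L) (t : term C) (y : L) :
  (nu f t <= y) = [forall c : cst C, (val c \in val t) ==> (f c <= y)].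
Proof.
have bigU (x : L) (r : seq (cst C)) (P : pred (cst C)) :
  (\big[Order.join/x]_(c <- r | P c) f c <= y) =
  (x <= y) && all (fun c => P c ==> (f c <= y)) r.
  elim: r => [|c r IH]; first by rewrite big_nil andbT.
  rewrite big_cons /=; case: (P c) => /=; last exact: IH.
  by rewrite leUx IH andbCA.
rewrite /nu bigU; apply/andP/forallP => [[_ /allP h] c|h].
  by apply: h; rewrite mem_index_enum.
split; last by apply/allP => c _; apply: h.
by have /implyP := h (some_cst t); apply; apply: (xchooseP (term_has_cst t)).
Qed.

Lemma nu_ge (T : finType) (C : {set T}) d (L : joinSemilatticeType d)
    (f : cst C -> L) (t : term C) (c : cst C) :
  val c \in val t -> f c <= nu f t.
Proof. by have := lexx (nu f t); rewrite {1}nu_le => /forallP/(_ c)/implyP. Qed.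

Lemma over1 (T : finType) (C : {set T}) (c : cst C) : over C [set val c].
Proof.
apply/andP; split; last by rewrite sub1set (valP c).
by apply/set0Pn; exists (val c); rewrite set11.
Qed.

Lemma overU (T : finType) (C t s : {set T}) :
  over C t -> over C s -> over C (t :|: s).
Proof.
move=> /andP[/set0Pn[c ct] tC] /andP[_ sC]; apply/andP; split.
  by apply/set0Pn; exists c; rewrite inE ct.
by rewrite subUset tC sC.
Qed.

Definition term1 (T : finType) (C : {set T}) (c : cst C) : term C :=
  Sub [set val c] (over1 c).

Definition termU (T : finType) (C : {set T}) (t s : term C) : term C :=
  Sub (val t :|: val s) (overU (valP t) (valP s)).

Lemma nu1 (T : finType) (C : {set T}) d (L : joinSemilatticeType d)
    (f : cst C -> L) (c : cst C) : nu f (term1 c) = f c.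
Proof.
apply/le_anti; rewrite nu_ge /= ?set11 // nu_le andbT.
apply/forallP => b; apply/implyP; rewrite inE => /eqP bc.
by rewrite (val_inj bc).
Qed.

Lemma nuU (T : finType) (C : {set T}) d (L : joinSemilatticeType d)
    (f : cst C -> L) (t s : term C) :
  nu f (termU t s) = nu f t `|` nu f s.
Proof.
apply/le_anti/andP; split.
  rewrite nu_le; apply/forallP => c; apply/implyP; rewrite /= inE.
  by case/orP => /(nu_ge f) h; [apply: lexUl | apply: lexUr].
by rewrite leUx !nu_le; apply/andP; split; apply/forallP => c;
  apply/implyP => h; apply: nu_ge; rewrite /= inE h ?orbT.
Qed.

Record model (T : finType) (C : {set T}) := Model {
  mdisp : Order.disp_t;
  carrier :> joinSemilatticeType mdisp;
  const : cst C -> carrier;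
  (* the image of const generates carrier; with C nonempty, so is carrier *)
  const_gen : forall P : carrier -> Prop,
    (forall c, P (const c)) -> (forall x y, P x -> P y -> P (x `|` y)) ->
    forall x, P x
}.

Arguments const {T C} M _ : rename.

Definition sat (T : finType) (C : {set T}) (M : model C) (r : duple C) : bool :=
  nu (const M) r.1 <= nu (const M) r.2.

Definition meq (T : finType) (C : {set T}) (K L : model C) : Prop :=
  forall r : duple C, sat K r = sat L r.

Definition freer (T : finType) (C : {set T}) (K L : model C) : Prop :=
  forall r : duple C, ~~ sat L r -> ~~ sat K r.

(* The subalgebra of L generated by the image of f, namely the range of nu f,
   as a model over C. *)
Definition gen_pred (T : finType) (C : {set T}) d (L : joinSemilatticeType d)
    (f : cst C -> L) : pred L :=
  fun x => [exists t : term C, x == nu f t].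

Record gen (T : finType) (C : {set T}) d (L : joinSemilatticeType d)
    (f : cst C -> L) := Gen { gval :> L; gvalP : gen_pred f gval }.

Section GenInstances.

Variables (T : finType) (C : {set T}) (d : Order.disp_t).
Variables (L : joinSemilatticeType d) (f : cst C -> L).

HB.instance Definition _ := [isSub of gen f for @gval T C d L f].
HB.instance Definition _ := [Choice of gen f by <:].
HB.instance Definition _ := [SubChoice_isSubPOrder of gen f by <: with d].

Lemma gen_joinP (x y : gen f) : gen_pred f (gval x `|` gval y).
Proof.
case: x y => [x /= /existsP[t /eqP->]] [y /= /existsP[s /eqP->]].
by apply/existsP; eexists; rewrite -nuU.
Qed.

Definition gen_join (x y : gen f) : gen f := Gen (gen_joinP x y).

Lemma gen_leUx (x y z : gen f) :
  (gen_join x y <= z) = (x <= z) && (y <= z).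
Proof. by rewrite -!Order.le_val leUx. Qed.

HB.instance Definition _ :=
  Order.POrder_isJoinSemilattice.Build d (gen f) gen_leUx.

Lemma gen_constP (c : cst C) : gen_pred f (f c).
Proof. by apply/existsP; eexists; rewrite -nu1. Qed.

Definition gen_const (c : cst C) : gen f := Gen (gen_constP c).

Lemma gval_nu (t : term C) : gval (nu gen_const t) = nu f t.
Proof. by rewrite /nu; apply: (big_morph (@gval T C d L f)). Qed.

Lemma gen_const_gen (P : gen f -> Prop) :
  (forall c, P (gen_const c)) -> (forall x y, P x -> P y -> P (x `|` y)) ->
  forall x, P x.
Proof.
move=> P1 PU x; have /existsP[t /eqP xt] := gvalP x.
have -> : x = nu gen_const t by apply: val_inj; rewrite /= gval_nu.
by apply: big_ind.
Qed.

Definition gen_model : model C := Model gen_const_gen.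

End GenInstances.

(* An atom is encoded by its set of upper constants. *)
Definition atomizes (T : finType) (C : {set T}) (A : {set {set T}})
    (M : model C) : bool :=
  [&& [forall phi in A, over C phi],
      [forall c in C, exists phi in A, below phi [set c]] &
      [forall t : term C, forall s : term C,
        (nu (const M) t <= nu (const M) s) ==
        ~~ [exists phi in A, below phi (val t) && ~~ below phi (val s)]]].

Definition atoms (T : finType) (C : {set T}) (M : model C) : {set {set T}} :=
  [set phi | [exists A : {set {set T}}, (phi \in A) && atomizes A M]].

Definition redundant (T : finType) (C : {set T}) (M : model C)
    (phi : {set T}) : bool :=
  over C phi &&
  [forall c in C, below phi [set c] ==>
    [exists eta in atoms M, below eta [set c] && (eta \proper phi)]].

(* The model [A] over C: the value of a term t is the set of atoms of A below
   t, and the order is inclusion. *)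
Definition amodel (T : finType) (C : {set T}) (A : {set {set T}}) : model C :=
  gen_model (fun c : cst C =>
    [set phi in A | below phi [set val c]]).

Lemma nu_amodel (T : finType) (C : {set T}) (A : {set {set T}}) (t : term C) :
  gval (nu (const (amodel C A)) t) = [set phi in A | below phi (val t)].
Proof.
rewrite gval_nu; apply/le_anti/andP; split.
  rewrite nu_le; apply/forallP => c; apply/implyP => ct.
  apply/subsetP => phi; rewrite !inE => /andP[-> /set0Pn[b]].
  rewrite !inE => /andP[bphi /eqP bc]; rewrite /below /=.
  by apply/set0Pn; exists (val c); rewrite inE ct -bc bphi.
apply/subsetP => phi; rewrite inE => /andP[phiA /set0Pn[b]].
rewrite inE => /andP[bphi bt].
have bC : b \in C by have /andP[_ /subsetP] := valP t; apply.
pose f (c : cst C) : {set {set T}} :=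
  [set phi in A | below phi [set val c]].
have /subsetP := @nu_ge T C _ _ f t (Sub b bC) bt; apply.
by rewrite inE phiA; apply/set0Pn; exists b; rewrite !inE bphi eqxx.
Qed.

Lemma amodelP (T : finType) (C : {set T}) (A : {set {set T}}) :
  (forall phi, phi \in A -> over C phi) ->
  (forall c, c \in C -> exists2 phi, phi \in A & below phi [set c]) ->
  atomizes A (amodel C A).
Proof.
move=> AC Acov; apply/and3P; split.
- by apply/forall_inP => phi /AC.
- by apply/forall_inP => c /Acov[phi ? ?]; apply/exists_inP; exists phi.
apply/forallP => t; apply/forallP => s; apply/eqP.
rewrite -Order.le_val /= !nu_amodel.
apply/subsetP/negP => [h /exists_inP[phi pA]|h phi].
  by case/andP=> pt; have := h phi; rewrite !inE pA pt /= => /(_ isT) ->.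
rewrite !inE => /andP[pA pt]; rewrite pA /=.
case: (boolP (below phi (val s))) => // ps.
by case: h; apply/exists_inP; exists phi => //; rewrite pt.
Qed.

Lemma atomizable (T : finType) (C : {set T}) (M : model C) :
  exists A, atomizes A M.
Proof.
pose f := const M.
pose ph (s : term C) := [set val c | c : cst C & ~~ (f c <= nu f s)].
have phE (s t : term C) :
    below (ph s) (val t) = ~~ (nu f t <= nu f s).
  rewrite nu_le negb_forall; apply/set0Pn/existsP => [[b]|[c]].
    rewrite inE => /andP[/imsetP[c]]; rewrite inE => h -> ct.
    by exists c; rewrite negb_imply ct.
  rewrite negb_imply => /andP[ct h]; exists (val c).
  by rewrite inE ct andbT imset_f // inE.
exists [set phi | over C phi && ((phi == C) || [exists s, phi == ph s])].
apply/and3P; split.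
- by apply/forall_inP => phi; rewrite inE => /andP[].
- apply/forall_inP => c cC; apply/exists_inP; exists C.
    rewrite inE eqxx /over subxx !andbT.
    by apply/set0Pn; exists c.
  by apply/set0Pn; exists c; rewrite !inE cC eqxx.
apply/forallP => t; apply/forallP => s; apply/eqP; apply/idP/negP.
  move=> ts /exists_inP[phi]; rewrite inE => /andP[_].
  case/orP => [/eqP->|/existsP[u /eqP->]].
    case/andP=> _ nCs; apply: (negP nCs); have /andP[/set0Pn[c cs] sC] := valP s.
    by apply/set0Pn; exists c; rewrite inE cs (subsetP sC).
  by rewrite !phE negbK => /andP[/negP tu us]; apply: tu; apply: le_trans ts us.
move=> h; case: (boolP (nu f t <= nu f s)) => // ts; case: h.
apply/exists_inP; exists (ph s); last first.
  by rewrite !phE lexx ts.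
rewrite inE; apply/andP; split; last first.
  by apply/orP; right; apply/existsP; exists s.
apply/andP; split; last first.
  by apply/subsetP => _ /imsetP[c _ ->]; apply: valP.
move: ts; rewrite -phE => /set0Pn[c]; rewrite inE => /andP[cs _].
by apply/set0Pn; exists c.
Qed.

Lemma atoms_atomizes (T : finType) (C : {set T}) (M : model C) :
  atomizes (atoms M) M.
Proof.
have [A hA] := atomizable M; have /and3P[AC Acov Ale] := hA.
have sA phi : phi \in A -> phi \in atoms M.
  by move=> pA; rewrite inE; apply/existsP; exists A; rewrite pA.
apply/and3P; split.
- apply/forall_inP => phi; rewrite inE => /existsP[B /andP[pB /and3P[h _ _]]].
  exact: (forall_inP h).
- apply/forall_inP => c /(forall_inP Acov)/exists_inP[phi pA pc].
  by apply/exists_inP; exists phi => //; apply: sA.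
apply/forallP => t; apply/forallP => s; apply/eqP.
apply/idP/negP => [ts /exists_inP[phi]|h].
  rewrite inE => /existsP[B /andP[pB /and3P[_ _ Ble]]] pts.
  have /forallP/(_ s)/eqP := forallP Ble t; rewrite ts => /esym/negP.
  by apply; apply/exists_inP; exists phi.
have /forallP/(_ s)/eqP-> := forallP Ale t.
apply/negP => /exists_inP[phi /sA pA pts].
by apply: h; apply/exists_inP; exists phi.
Qed.

(* The model does not depend on the chosen sets of atoms; all atoms are
   taken. *)
Definition union_model (T : finType) (CM CN : {set T}) (M : model CM)
    (N : model CN) : model (CM :|: CN) :=
  amodel (CM :|: CN) (atoms M :|: atoms N).

Definition cross_atoms (T : finType) (l r : {set T}) (A : {set {set T}}) :
    {set {set T}} :=
  let H := [set phi in A | below phi l && ~~ below phi r] in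
  let B := [set phi in A | below phi r] in
  (A :\: H) :|: [set lambda :|: rho | lambda in H, rho in B].

(* Full crossing of the duple (l, r), where l and r are terms over C; here too
   the set of all atoms stands for an arbitrary atomization. *)
Definition crossing (T : finType) (C : {set T}) (l r : {set T})
    (M : model C) : model C :=
  amodel C (cross_atoms l r (atoms M)).

Definition crossing_eq (T : finType) (C : {set T}) (c c' : T)
    (M : model C) : model C :=
  crossing [set c] [set c'] (crossing [set c'] [set c] M).

Definition restrict (T : finType) (C Q : {set T}) (sQC : Q \subset C)
    (M : model C) : model Q :=
  gen_model (fun c : cst Q =>
    const M (Sub (val c) (subsetP sQC _ (valP c)))).

Lemma imset_cst (T : finType) (C : {set T}) (f : T -> T) (c : cst (f @: C)) :
  exists b : cst C, f (val b) == val c.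
Proof. by have /imsetP[b bC ->] := valP c; exists (Sub b bC). Qed.

(* M with each constant c renamed f c, for f injective on C. *)
Definition rename (T : finType) (C : {set T}) (f : T -> T) (M : model C) :
    model (f @: C) :=
  gen_model (fun c : cst (f @: C) => const M (xchoose (imset_cst c))).

Definition is_hom d1 d2 (K : joinSemilatticeType d1)
    (L : joinSemilatticeType d2) (f : K -> L) : Prop :=
  {morph f : x y / x `|` y}.

Definition isomorphic d1 d2 (K : joinSemilatticeType d1)
    (L : joinSemilatticeType d2) : Prop :=
  exists2 f : K -> L, is_hom f & bijective f.

Definition keeps_consts (T : finType) (C D : {set T}) (M : model C)
    (P : model D) (f : M -> P) : Prop :=
  forall (c : cst C) (d : cst D),
    val c = val d -> f (const M c) = const P d.

Definition embeds (T : finType) (C D : {set T}) (M : model C) (P : model D) :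
    Prop :=
  exists f : M -> P, [/\ is_hom f, keeps_consts f & injective f].

(* P is the join model of M and N when CM and CN are disjoint. *)
Definition is_free_join (T : finType) (CM CN : {set T}) (M : model CM)
    (N : model CN) (P : model (CM :|: CN)) : Prop :=
  [/\ embeds M P, embeds N P &
      forall P' : model (CM :|: CN),
        embeds M P' -> embeds N P' -> freer P P'].

Definition congruence d (L : joinSemilatticeType d) (R : L -> L -> Prop) :
    Prop :=
  [/\ forall x, R x x,
      forall x y, R x y -> R y x,
      forall x y z, R x y -> R y z -> R x z &
      forall x x' y y', R x x' -> R y y' -> R (x `|` y) (x' `|` y')].

Definition cong_closure d (L : joinSemilatticeType d) (S : L -> L -> Prop) :
    L -> L -> Prop :=
  fun x y => forall R : L -> L -> Prop,
    congruence R -> (forall a b, S a b -> R a b) -> R x y.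

(* The renaming that takes each constant of N shared with M to its copy. *)
Definition primed (T : finType) (CM : {set T}) (prime : T -> T) (x : T) : T :=
  if x \in CM then prime x else x.

(* J is the join model of M and N, where prime maps the common constants to
   new ones: a quotient of the join P of M and the renamed copy of N by the
   least congruence identifying each common constant with its copy. Since the
   constants c and prime c have the same image in J, renaming prime c back to
   c amounts to sending every constant of P that is in CM :|: CN to the
   constant of J of the same name. *)
Definition is_join (T : finType) (CM CN : {set T}) (prime : T -> T)
    (M : model CM) (N : model CN) (J : model (CM :|: CN)) : Prop :=
  let N' := rename (primed CM prime) N in
  exists2 P, is_free_join M N' P &
  exists q : P -> J,
    [/\ is_hom q,
        forall y, exists x, q x = y,
        forall x y, q x = q y <->
          cong_closure (fun a b => exists c d,
            [/\ val c \in CM :&: CN, val d = prime (val c),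
                a = const P c & b = const P d]) x y &
        keeps_consts q].

(* Main.v *)
Require Import Defs.
From mathcomp Require Import all_boot all_order boolp.
Set Implicit Arguments.
Unset Strict Implicit.
Unset Printing Implicit Defensive.

Import Order.TTheory Defs.
Local Open Scope order_scope.

(* An atom phi is in M iff it discriminates no positive duple of M (atomsP), so
   that the atoms of M form a family closed under union which determines M, and
   the order of freeness is the inclusion of these families. In such a family,
   crossing (l, r) only removes the atoms below l and not below r: hence
   box_E (M + N') has as atoms the atoms of M + N' containing c_i iff they contain
   c'_i. As M + N' is the free join of M and N', and the kernel of the natural
   map M + N' -> box_E (M + N') is the congruence identifying c_i with c'_i, the
   join model is isomorphic to box_E (M + N'). Each atom of the join model is the
   union of its traces on C_M and C_N, which are empty or atoms of M and of N, so
   all atoms of the join model are atoms of M + N (the redundancy alternative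
   never has to be used), and crossing all the positive duples of the join model
   in M + N leaves just these atoms. *)

(** * Homomorphisms out of a model, and quotients *)

Section Homomorphisms.

Variables (T : finType) (C : {set T}).

Lemma eq_nu d (L : joinSemilatticeType d) (f g : cst C -> L) :
  f =1 g -> nu f =1 nu g.
Proof. by move=> fg t; rewrite /nu fg; apply: eq_bigr => c _; apply: fg. Qed.

Lemma hom_nu d1 d2 (K : joinSemilatticeType d1) (L : joinSemilatticeType d2)
    (g : K -> L) (f : cst C -> K) (t : term C) :
  is_hom g -> g (nu f t) = nu (g \o f) t.
Proof. by move=> hg; apply: (big_morph g hg). Qed.

Lemma hom_le d1 d2 (K : joinSemilatticeType d1) (L : joinSemilatticeType d2)
    (g : K -> L) (x y : K) : is_hom g -> x <= y -> g x <= g y.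
Proof. by move=> hg /join_idPl xy; apply/join_idPl; rewrite -hg xy. Qed.

Lemma inj_hom_le d1 d2 (K : joinSemilatticeType d1)
    (L : joinSemilatticeType d2) (g : K -> L) (x y : K) :
  is_hom g -> injective g -> (g x <= g y) = (x <= y).
Proof.
move=> hg ig; apply/idP/idP; last exact: hom_le.
by move=> /join_idPl; rewrite -hg => /ig /join_idPl.
Qed.

Lemma nu_surj (K : model C) (x : K) : exists t, x = nu (const K) t.
Proof.
apply: (@const_gen _ _ K (fun x => exists t, x = nu (const K) t)) => [c|y z].
  by exists (term1 c); rewrite nu1.
by move=> [t ->] [s ->]; exists (termU t s); rewrite nuU.
Qed.

(** An element is represented by a term chosen with [xchoose]; the hypothesis, applied both ways,
    makes the value independent of the choice. *)
Lemma nu_lift (K : model C) d (L : joinSemilatticeType d) (f : cst C -> L) :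
  (forall t s, nu (const K) t <= nu (const K) s -> nu f t <= nu f s) ->
  exists2 h : K -> L, is_hom h & forall t, h (nu (const K) t) = nu f t.
Proof.
move=> Kf.
have ex x : exists t, x == nu (const K) t.
  by have [t ->] := nu_surj x; exists t.
pose h x := nu f (xchoose (ex x)).
have hE t : h (nu (const K) t) = nu f t.
  have /eqP e := xchooseP (ex (nu (const K) t)).
  by apply/le_anti; rewrite !Kf // -e.
exists h => // x y; have [t ->] := nu_surj x; have [s ->] := nu_surj y.
by rewrite -nuU !hE nuU.
Qed.

Lemma hom_onto (K : model C) d (P : joinSemilatticeType d) (g : P -> K) :
  is_hom g -> (forall c, exists x, g x = const K c) ->
  forall y, exists x, g x = y.
Proof.
move=> hg gc; apply: const_gen => // _ _ [x <-] [y <-].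
by exists (x `|` y); rewrite hg.
Qed.

End Homomorphisms.

(** First isomorphism theorem: the two inverse maps go through preimages in [P], whose choice the
    common kernel makes harmless. *)
Lemma hom_iso d d1 d2 (P : joinSemilatticeType d) (J : joinSemilatticeType d1)
    (B : joinSemilatticeType d2) (q : P -> J) (p : P -> B) :
  is_hom q -> is_hom p ->
  (forall y, exists x, q x = y) -> (forall y, exists x, p x = y) ->
  (forall x y, q x = q y <-> p x = p y) ->
  exists h : J -> B, [/\ is_hom h, bijective h & forall x, h (q x) = p x].
Proof.
move=> hq hp sq sp ker.
have exq y : exists x, q x == y by have [x <-] := sq y; exists x.
have exp y : exists x, p x == y by have [x <-] := sp y; exists x.
pose h y := p (xchoose (exq y)); pose k y := q (xchoose (exp y)).
have hE x : h (q x) = p x by apply/ker/eqP/(xchooseP (exq _)).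
have kE x : k (p x) = q x by apply/ker/eqP/(xchooseP (exp _)).
clearbody h k; exists h; split=> // [x y|].
  by have [a <-] := sq x; have [b <-] := sq y; rewrite -hq !hE hp.
by exists k => y; [have [x <-] := sq y | have [x <-] := sp y]; rewrite ?hE ?kE ?hE.
Qed.

(** * Terms over a smaller set of constants *)

Section Inclusion.

Variables (T : finType) (Q C : {set T}) (sQC : Q \subset C).

Definition cst_incl (c : cst Q) : cst C :=
  Sub (val c) (subsetP sQC _ (valP c)).

Lemma over_incl (t : term Q) : over C (val t).
Proof.
by have /andP[t0 tQ] := valP t; rewrite /over t0 (subset_trans tQ sQC).
Qed.

Definition term_incl (t : term Q) : term C := Sub (val t) (over_incl t).

Lemma nu_incl d (L : joinSemilatticeType d) (f : cst C -> L) (t : term Q) :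
  nu (f \o cst_incl) t = nu f (term_incl t).
Proof.
apply/le_anti/andP; split; rewrite nu_le; apply/forallP => c; apply/implyP => ct.
  exact: (@nu_ge _ _ _ _ f (term_incl t) (cst_incl c) ct).
have cQ : val c \in Q by have /andP[_ /subsetP] := valP t; apply.
have -> : c = cst_incl (Sub (val c) cQ) by apply: val_inj.
exact: (@nu_ge _ _ _ _ (f \o cst_incl) t (Sub (val c) cQ) ct).
Qed.

End Inclusion.

(** * Atoms of a model, freeness and full crossing *)

Section Atoms.

Variables (T : finType) (C : {set T}).
Implicit Types (K L M : model C) (phi psi : {set T}) (t s : term C).

Lemma belowU phi psi (t : {set T}) :
  below (phi :|: psi) t = below phi t || below psi t.
Proof. by rewrite /below setIUl setU_eq0 negb_and. Qed.

Lemma below1 phi c : below phi [set c] = (c \in phi).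
Proof.
apply/set0Pn/idP => [[b]|cphi]; first by rewrite !inE => /andP[bp /eqP <-].
by exists c; rewrite !inE cphi eqxx.
Qed.

Lemma atomizes_sat (A : {set {set T}}) M t s :
  atomizes A M ->
  reflect (forall phi, phi \in A -> below phi (val t) -> below phi (val s))
          (sat M (t, s)).
Proof.
case/and3P=> _ _ /forallP/(_ t)/forallP/(_ s)/eqP; rewrite /sat /= => ->.
apply: (iffP idP) => [/negP h phi pA pt|h].
  apply: contra_notT h => ps; apply/exists_inP; exists phi => //.
  by rewrite pt.
by apply/negP => /exists_inP[phi pA /andP[/(h _ pA) ->]].
Qed.

Definition atoms_satP M t s := atomizes_sat t s (atoms_atomizes M).

Lemma atoms_over M phi : phi \in atoms M -> over C phi.
Proof. by have /and3P[/forall_inP h _ _] := atoms_atomizes M; apply: h. Qed.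

Lemma atoms_cover M c :
  c \in C -> exists2 phi, phi \in atoms M & below phi [set c].
Proof.
move=> cC; have /and3P[_ /forall_inP/(_ _ cC)/exists_inP[phi]] := atoms_atomizes M.
by exists phi.
Qed.

(** An atom that discriminates no positive duple can be added to an atomization without changing the
    order it defines. *)
Lemma atomsP M phi :
  reflect (over C phi /\
           forall t s, sat M (t, s) -> below phi (val t) -> below phi (val s))
          (phi \in atoms M).
Proof.
apply: (iffP idP) => [pM|[oC h]].
  by split=> [|t s /atoms_satP]; [exact: atoms_over pM | apply].
rewrite inE; apply/existsP; exists (phi |: atoms M); rewrite setU11 /=.
apply/and3P; split.
- by apply/forall_inP => psi /setU1P[->//|/atoms_over].
- apply/forall_inP => c /(atoms_cover M)[psi pM pc].
  by apply/exists_inP; exists psi => //; rewrite inE pM orbT.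
apply/forallP => t; apply/forallP => s; apply/eqP; rewrite -[LHS]/(sat M (t, s)).
apply/idP/negP => [ts /exists_inP[psi]|nex].
  move=> /setU1P[->|pM] /andP[pt] /negP; apply; first exact: h ts pt.
  by move/atoms_satP: ts; apply.
apply/atoms_satP => psi pM pt; apply: contra_notT nex => ps.
by apply/exists_inP; exists psi; rewrite ?pt // inE pM orbT.
Qed.

Lemma atomizes_atoms (A : {set {set T}}) M : atomizes A M -> A \subset atoms M.
Proof.
by move=> AM; apply/subsetP => phi pA; rewrite inE; apply/existsP; exists A;
  rewrite pA.
Qed.

Lemma atomsU M phi psi :
  phi \in atoms M -> psi \in atoms M -> phi :|: psi \in atoms M.
Proof.
move=> /atomsP[op hp] /atomsP[os hs]; apply/atomsP; split; first exact: overU.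
by move=> t s ts; rewrite !belowU => /orP[/(hp _ _ ts)->//|/(hs _ _ ts)->];
  rewrite orbT.
Qed.

(** The atom [C] is below every term, so it discriminates no duple. *)
Lemma atoms_setT M : C != set0 -> C \in atoms M.
Proof.
move=> C0; apply/atomsP; split; first by rewrite /over C0 subxx.
by move=> t s _ _; have /andP[s0 /setIidPr] := valP s; rewrite /below => ->.
Qed.

(** More positive duples put more conditions on an atom in [atomsP]; conversely, fewer atoms
    discriminate fewer duples. *)
Lemma freer_atoms K L : freer K L <-> atoms L \subset atoms K.
Proof.
split=> [KL|/subsetP LK r].
  apply/subsetP => phi /atomsP[oC h]; apply/atomsP; split=> // t s ts; apply: h.
  by apply: contraLR ts => /KL.
by case: r => t s; apply: contraNN => /atoms_satP h; apply/atoms_satP => phi /LK;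
  apply: h.
Qed.

Lemma freer_antisym K L : freer K L -> freer L K -> meq K L.
Proof. by move=> KL LK r; apply/idP/idP; apply: contraLR; [apply: KL | apply: LK]. Qed.

(** Each union of [lambda] and [rho] already lies in [A] and is below [r], so only the removal of
    discriminating atoms has an effect. *)
Lemma cross_atomsE (l r : {set T}) (A : {set {set T}}) :
  {in A &, forall phi psi, phi :|: psi \in A} ->
  cross_atoms l r A = [set phi in A | below phi l ==> below phi r].
Proof.
move=> AU; apply/setP => phi; rewrite !inE; apply/orP/andP.
  case=> [/andP[+ pA]|/imset2P[la rho]].
    by rewrite pA /= negb_and negbK -implybE.
  rewrite !inE => /andP[lA _] /andP[rA rr] ->.
  by rewrite AU ?belowU ?rr ?orbT ?implybT.
by case=> pA; rewrite pA implybE => h; left; rewrite /= negb_and negbK andbT.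
Qed.

Lemma atoms_crossing (l r : {set T}) M phi :
  over C l -> over C r ->
  (phi \in atoms (crossing l r M)) =
  (phi \in atoms M) && (below phi l ==> below phi r).
Proof.
move=> ol or.
have crossE := cross_atomsE l r (@atomsU M).
have C0 : C != set0.
  by have /andP[/set0Pn[c cl] /subsetP lC] := ol; apply/set0Pn; exists c; apply: lC.
have AX : atomizes (cross_atoms l r (atoms M)) (crossing l r M).
  rewrite /crossing crossE; apply: amodelP => [psi|c cC].
    by rewrite inE => /andP[/atoms_over].
  (* The atom [C] survives the crossing and covers every constant. *)
  exists C; last by rewrite below1.
  rewrite inE atoms_setT //=; have /andP[r0 /setIidPr] := or.
  by rewrite {2}/below => ->; rewrite r0 implybT.
apply/idP/idP => [pX|pM]; last first.
  by apply: (subsetP (atomizes_atoms AX)); rewrite crossE inE.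
(* An atom of the crossing respects the positive duples of [M], which stay positive as atoms are
   only removed, and also [(l, r)], now positive. *)
have [oC h] := atomsP _ _ pX; apply/andP; split.
  apply/atomsP; split=> // t s /atoms_satP ts; apply: h.
  by apply/(atomizes_sat _ _ AX) => psi; rewrite crossE inE => /andP[+ _]; apply: ts.
apply/implyP; apply: (h (Sub l ol) (Sub r or)); apply/(atomizes_sat _ _ AX) => psi.
by rewrite crossE inE => /andP[_ /implyP].
Qed.

Lemma atoms_crossing_eq (c c' : T) M phi :
  c \in C -> c' \in C ->
  (phi \in atoms (crossing_eq c c' M)) =
  (phi \in atoms M) && ((c \in phi) == (c' \in phi)).
Proof.
move=> cC cC'.
have oc : over C [set c] := over1 (Sub c cC : cst C).
have oc' : over C [set c'] := over1 (Sub c' cC' : cst C).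
rewrite (atoms_crossing _ _ oc oc') (atoms_crossing _ _ oc' oc) !below1 -andbA.
congr andb.
by case: (c \in phi); case: (c' \in phi).
Qed.

Lemma atoms_foldr_crossing_eq (f : T -> T) (cs : seq T) M phi :
  {in cs, forall c, c \in C /\ f c \in C} ->
  (phi \in atoms (foldr (fun c K => crossing_eq c (f c) K) M cs)) =
  (phi \in atoms M) && all (fun c => (c \in phi) == (f c \in phi)) cs.
Proof.
elim: cs => [_|c cs IH h] /=; first by rewrite andbT.
have [cC fC] := h c (mem_head c cs).
rewrite atoms_crossing_eq // IH 1?andbAC ?andbA // => b bcs.
by apply: h; rewrite inE bcs orbT.
Qed.

Lemma atoms_foldr_crossing (rs : seq (duple C)) M phi :
  (phi \in atoms (foldr (fun r K => crossing (val r.1) (val r.2) K) M rs)) =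
  (phi \in atoms M) &&
  all (fun r => below phi (val r.1) ==> below phi (val r.2)) rs.
Proof.
elim: rs => [|r rs IH] /=; first by rewrite andbT.
by rewrite atoms_crossing ?(valP r.1) ?(valP r.2) // IH -andbA [X in _ && X]andbC.
Qed.

Lemma freer_crossings K L :
  freer K L ->
  exists rs : seq (duple C),
    meq L (foldr (fun r K' => crossing (val r.1) (val r.2) K') K rs).
Proof.
(* Crossing every positive duple of [L] leaves the atoms of [K] that discriminate none of them; by
   [atomsP] these are atoms of [L]. *)
move=> /freer_atoms/subsetP LK; exists [seq r <- enum {: duple C} | sat L r].
apply: freer_antisym; apply/freer_atoms/subsetP => phi; last first.
  move=> pL; rewrite atoms_foldr_crossing LK //=; apply/allP => -[t s].
  rewrite mem_filter => /andP[Lts _]; apply/implyP.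
  by move: t s Lts; apply: (proj2 (atomsP _ _ pL)).
rewrite atoms_foldr_crossing => /andP[/atoms_over oC /allP h].
apply/atomsP; split=> // t s ts; apply/implyP/(h (t, s)).
by rewrite mem_filter ts mem_enum.
Qed.

End Atoms.

(** * The union model and traces of atoms *)

Section UnionModel.

Variables (T : finType) (CM CN : {set T}) (M : model CM) (N : model CN).

Let sM : CM \subset CM :|: CN := subsetUl CM CN.
Let sN : CN \subset CM :|: CN := subsetUr CM CN.

Lemma union_atomizes : atomizes (atoms M :|: atoms N) (union_model M N).
Proof.
apply: amodelP => [phi|c].
  move=> /setUP[] /atoms_over/andP[p0 sp]; rewrite /over p0.
    exact: subset_trans sp sM.
  exact: subset_trans sp sN.
by move=> /setUP[] /[dup] cC; [case/(atoms_cover M) | case/(atoms_cover N)]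
   => phi pA pc; exists phi; rewrite // inE pA ?orbT.
Qed.

(** A term over [Q] meets [phi] iff it meets the trace, so the trace discriminates a duple over [Q]
    only if [phi] does. *)
Lemma sub_atom (Q C : {set T}) (sQC : Q \subset C) (L : model Q) (K : model C)
    phi :
  (forall t s, sat L (t, s) ->
     nu (const K \o cst_incl sQC) t <= nu (const K \o cst_incl sQC) s) ->
  phi \in atoms K -> phi :&: Q != set0 -> phi :&: Q \in atoms L.
Proof.
move=> LK /atomsP[_ h] pQ0; apply/atomsP; split; first by rewrite /over pQ0 subsetIr.
have belowE (t : term Q) : below (phi :&: Q) (val t) = below phi (val t).
  by have /andP[_ /setIidPr tQ] := valP t; rewrite /below -setIA tQ.
move=> t s /LK; rewrite !nu_incl !belowE; exact: h.
Qed.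

(** An atom of [K] is the union of its traces on [CM] and [CN], and the nonempty ones are atoms of
    the union model. *)
Lemma union_freer (K : model (CM :|: CN)) :
  (forall t s, sat M (t, s) ->
     nu (const K \o cst_incl sM) t <= nu (const K \o cst_incl sM) s) ->
  (forall t s, sat N (t, s) ->
     nu (const K \o cst_incl sN) t <= nu (const K \o cst_incl sN) s) ->
  freer (union_model M N) K.
Proof.
move=> MK NK; apply/freer_atoms/subsetP => phi pK.
have /subsetP AU := atomizes_atoms union_atomizes.
have AM : phi :&: CM != set0 -> phi :&: CM \in atoms (union_model M N).
  by move=> /(sub_atom MK pK) pM; apply: AU; rewrite inE pM.
have AN : phi :&: CN != set0 -> phi :&: CN \in atoms (union_model M N).
  by move=> /(sub_atom NK pK) pN; apply: AU; rewrite inE pN orbT.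
have /andP[p0 /setIidPl pE] := atoms_over pK.
move: p0; rewrite -pE setIUr setU_eq0.
have [->|/AM pM] := eqVneq (phi :&: CM) set0; first by rewrite set0U.
have [->|/AN pN _] := eqVneq (phi :&: CN) set0; first by rewrite setU0.
exact: atomsU.
Qed.

End UnionModel.

(** * Natural homomorphisms and their kernels *)

Section Models.

Variables (T : finType) (C : {set T}).
Implicit Types (K L : model C) (t s : term C).

Lemma freer_sat K L r : freer K L -> sat K r -> sat L r.
Proof. by move=> KL; apply: contraLR; apply: KL. Qed.

Lemma freer_hom K L :
  freer K L ->
  exists2 p : K -> L, is_hom p & forall c, p (const K c) = const L c.
Proof.
move=> KL; have [t s|p hp pE] := @nu_lift _ _ K _ L (const L).
  exact: (@freer_sat K L (t, s)).
by exists p => // c; rewrite -nu1 pE nu1.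
Qed.

Lemma hom_const_le K d (L : joinSemilatticeType d) (g : K -> L) (f : cst C -> L)
    t s :
  is_hom g -> (forall c, g (const K c) = f c) ->
  sat K (t, s) -> nu f t <= nu f s.
Proof.
move=> hg gE ts; have e : g \o const K =1 f by move=> c; apply: gE.
by rewrite -!(eq_nu e) -!(hom_nu _ _ hg); apply: (hom_le hg).
Qed.

Lemma const_eq K (c d : cst C) :
  (forall phi, phi \in atoms K -> (val c \in phi) = (val d \in phi)) ->
  const K c = const K d.
Proof.
move=> cd; rewrite -2!nu1; apply/le_anti/andP.
by split; apply/(atoms_satP K (term1 _) (term1 _)) => phi /cd e;
  rewrite /= !below1 e.
Qed.

End Models.

(* For the inclusion of the kernel in the closure, let R be a congruence as in
   the closure and s a term: the set phi of the constants c such that s `|` c is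
   not R-related to s is, if nonempty, an atom of B that is not below s. *)
Lemma hom_cong_closure (T : finType) (C : {set T}) (K B : model C) (D : {set T})
    (f : T -> T) (p : K -> B) (x y : K) :
  D \subset C -> f @: D \subset C ->
  is_hom p -> (forall c, p (const K c) = const B c) ->
  (forall phi, (phi \in atoms B) =
     (phi \in atoms K) && [forall c in D, (c \in phi) == (f c \in phi)]) ->
  p x = p y <->
  cong_closure (fun a b => exists c d,
    [/\ val c \in D, val d = f (val c), a = const K c & b = const K d]) x y.
Proof.
move=> DC fDC hp pc atB.
have pE t : p (nu (const K) t) = nu (const B) t.
  by rewrite (hom_nu _ _ hp); apply: eq_nu.
split=> [|cxy]; last first.
  (* The kernel of [p] is a congruence; it contains the generating pairs because no atom of [B]
     separates [c] from [f c]. *)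
  apply: (cxy (fun a b => p a = p b)) => [|a b [c [d [cD dE -> ->]]]].
    by split=> // [a b c -> //|a a' b b' aa bb]; rewrite !hp aa bb.
  rewrite !pc; apply: const_eq => phi; rewrite atB => /andP[_].
  by move=> /forall_inP/(_ _ cD)/eqP; rewrite dE.
move=> pxy R [Rr Rs Rt RU] SR.
(* It suffices that [a] absorbs [b] modulo [R] whenever it does so in [B]: then both [x] and [y] are
   related to their join. *)
suff main a b : p b <= p a -> R (a `|` b) a.
  apply: Rt (Rs _ _ (main x y _)) _; first by rewrite pxy.
  by rewrite joinC; apply: main; rewrite pxy.
have [s ->] := nu_surj a; have [t ->] := nu_surj b; rewrite !pE => {x y pxy a b}.
set a := nu (const K) s => ts.
have RUl u v : R u v -> R (a `|` u) (a `|` v) by move=> uv; apply: RU.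
pose phi := [set val c | c : cst C & ~~ `[< R (a `|` const K c) a >]].
have phiE (c : cst C) : (val c \in phi) = ~~ `[< R (a `|` const K c) a >].
  apply/imsetP/idP => [[d + /val_inj ->]|h]; first by rewrite inE.
  by exists c; rewrite ?inE.
(* Modulo [R], [a] absorbs a term iff it absorbs each of its constants. *)
have belowE (u : term C) : reflect (R (a `|` nu (const K) u) a)
    (~~ below phi (val u)).
  apply: (iffP idP) => [nu0|Ru].
    have : forall c : cst C, val c \in val u -> R (a `|` const K c) a.
      move=> c cu; apply/asboolP; rewrite -[asbool _]negbK -phiE.
      by apply: contraNN nu0 => cp; apply/set0Pn; exists (val c); rewrite inE cp.
    rewrite /nu => Rc; apply: (big_ind (fun v => R (a `|` v) a)) => [|v w Rv Rw|c cu]; last exact: Rc.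
      (* The iterated join starts from [some_cst u], itself a constant of [u]. *)
      exact/Rc/(xchooseP (term_has_cst u)).
    by rewrite joinA; apply: Rt (RU _ _ _ _ Rv (Rr w)) Rw.
  apply/negP => /set0Pn[b]; rewrite inE => /andP[bp bu].
  have bC : b \in C by have /andP[_ /subsetP] := valP u; apply.
  move: bp; rewrite -[b]/(val (Sub b bC : cst C)) phiE => /negP; apply.
  apply/asboolP; have bu' := @nu_ge _ _ _ _ (const K) u (Sub b bC) bu.
  apply: Rt (RU _ _ _ _ (Rs _ _ Ru) (Rr _)) _.
  by rewrite -joinA (join_l bu').
(* Otherwise [phi] is below [t]; being an atom of [B], it is below [s] by [ts], although [a] absorbs
   itself. *)
apply/belowE/negP => pt.
have phiB : phi \in atoms B.
  rewrite atB; apply/andP; split.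
    apply/atomsP; split=> [|u v uv].
      apply/andP; split; last first.
        by apply/subsetP => _ /imsetP[c _ ->]; apply: valP.
      by apply: contraTneq pt => ->; rewrite /below set0I eqxx.
    apply: contraTT => /belowE Rv; apply/belowE.
    apply: Rt (RU _ _ _ _ (Rs _ _ Rv) (Rr _)) _.
    by rewrite -joinA (join_l (uv : nu (const K) u <= nu (const K) v)).
  apply/forall_inP => c cD; apply/eqP.
  have cC := subsetP DC c cD; have fC := subsetP fDC _ (imset_f f cD).
  rewrite -[c in LHS]/(val (Sub c cC : cst C)) -[f c]/(val (Sub (f c) fC : cst C)).
  (* As [c] and [f c] are related, [a] absorbs both or neither. *)
  have Rcf : R (const K (Sub c cC)) (const K (Sub (f c) fC)).
    by apply: SR; exists (Sub c cC), (Sub (f c) fC).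
  rewrite !phiE; congr (~~ _); apply: asbool_equiv_eq; split=> h.
    exact: Rt (RUl _ _ (Rs _ _ Rcf)) h.
  exact: Rt (RUl _ _ Rcf) h.
have ps : below phi (val s) by move/atoms_satP: ts => /(_ phi phiB pt).
have : R (a `|` a) a by rewrite joinxx; apply: Rr.
by move/belowE; rewrite ps.
Qed.

(** * Free joins and renaming *)

Lemma embeds_sat (T : finType) (Q C : {set T}) (sQC : Q \subset C)
    (L : model Q) (K : model C) :
  (forall t s, sat L (t, s) =
     (nu (const K \o cst_incl sQC) t <= nu (const K \o cst_incl sQC) s)) ->
  embeds L K.
Proof.
move=> LK; have [t s|h hh hE] := @nu_lift _ _ L _ K (const K \o cst_incl sQC).
  by rewrite -LK.
exists h; split=> // [c d cd|x y].
  by rewrite -nu1 hE nu1 /=; congr const; apply: val_inj.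
have [t ->] := nu_surj x; have [s ->] := nu_surj y; rewrite !hE => e.
by apply/le_anti/andP; split; [rewrite -[_ <= _]/(sat L (t, s)) |
  rewrite -[_ <= _]/(sat L (s, t))]; rewrite LK e.
Qed.

(** By disjointness, an atom of one model is below no term over the constants of the other, so both
    models embed; [union_freer] gives freeness. *)
Lemma union_free_join (T : finType) (CM CN : {set T}) (M : model CM)
    (N : model CN) :
  [disjoint CM & CN] -> is_free_join M N (union_model M N).
Proof.
move=> dMN; have AU := union_atomizes M N.
split.
- apply: (@embeds_sat _ _ _ (subsetUl CM CN)) => t s; rewrite !nu_incl.
  apply/idP/idP => [/atoms_satP ts|/(atomizes_sat _ _ AU) ts].
    apply/(atomizes_sat _ _ AU) => phi /setUP[/ts //|/atoms_over].
    case/andP=> _ pN /set0Pn[b]; rewrite inE => /andP[bp bt].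
    have /andP[_ /subsetP tM] := valP t.
    by have := disjointFl dMN (subsetP pN b bp); rewrite tM.
  by apply/atoms_satP => phi pM; apply: ts; rewrite inE pM.
- apply: (@embeds_sat _ _ _ (subsetUr CM CN)) => t s; rewrite !nu_incl.
  apply/idP/idP => [/atoms_satP ts|/(atomizes_sat _ _ AU) ts].
    apply/(atomizes_sat _ _ AU) => phi /setUP[/atoms_over|/ts //].
    case/andP=> _ pM /set0Pn[b]; rewrite inE => /andP[bp bt].
    have /andP[_ /subsetP tN] := valP t.
    by have := disjointFr dMN (subsetP pM b bp); rewrite tN.
  by apply/atoms_satP => phi pN; apply: ts; rewrite inE pN orbT.
move=> P [g [hg kg _]] [g' [hg' kg' _]].
by apply: union_freer => t s; [apply: (hom_const_le hg) | apply: (hom_const_le hg')]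
  => c; [apply: kg | apply: kg'].
Qed.

Lemma rename_hom (T : finType) (C : {set T}) (f : T -> T) (K : model C) :
  {in C &, injective f} ->
  exists2 e : K -> rename f K, is_hom e &
    forall (c : cst C) d, val d = f (val c) ->
      e (const K c) = const (rename f K) d.
Proof.
move=> fI; pose fc (c : cst C) : cst (f @: C) := Sub (f (val c)) (imset_f f (valP c)).
pose k c := const (rename f K) (fc c).
(* By injectivity of [f], the preimage of [d] picked in [rename] is [c] itself. *)
have kE (c : cst C) d : val d = f (val c) -> gval (const (rename f K) d) = const K c.
  move=> dE; rewrite /=; congr const; apply/val_inj/fI; try exact: valP.
  by rewrite -dE; apply/eqP/(xchooseP (imset_cst d)).
have gk (t : term C) : gval (nu k t) = nu (const K) t.
  rewrite (@hom_nu _ _ _ _ _ _ (@gval _ _ _ _ _)) //.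
  by apply: eq_nu => c; apply: kE.
have [t s|e he eE] := @nu_lift _ _ K _ (rename f K) k.
  by rewrite -!gk Order.le_val.
exists e => // c d dE; rewrite -nu1 eE nu1; apply: val_inj.
exact: etrans (kE c (fc c) erefl) (esym (kE c d dE)).
Qed.

(** Each of the two models is freest, hence freer than the other. *)
Lemma free_join_atoms (T : finType) (CM CN : {set T}) (M : model CM)
    (N : model CN) (P : model (CM :|: CN)) :
  [disjoint CM & CN] -> is_free_join M N P ->
  atoms P = atoms (union_model M N).
Proof.
move=> /(union_free_join M N) [eM eN fU] [eM' eN' fP].
by apply/eqP; rewrite eqEsubset; apply/andP; split; apply/freer_atoms;
  [apply: fU | apply: fP].
Qed.

(** * The join model as a quotient of the free join *)

Theorem theorem31 (T : finType) (CM CN : {set T}) (M : model CM) (N : model CN)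
    (cs : seq T) (prime : T -> T) (cs_uniq : uniq cs)
    (csE : cs =i CM :&: CN) (cs_neq0 : CM :&: CN != set0)
    (prime_inj : {in CM :&: CN &, injective prime})
    (prime_new : forall c, c \in CM :&: CN -> prime c \notin CM :|: CN) :
  let N' := rename (primed CM prime) N in
  let CN' := primed CM prime @: CN in
  let boxE := foldr (fun c (K : model (CM :|: CN')) =>
                       crossing_eq c (prime c) K) (union_model M N') cs in
  (exists J : model (CM :|: CN), is_join prime M N J) /\
  forall J : model (CM :|: CN), is_join prime M N J ->
    [/\ isomorphic J boxE,
        exists sQ : CM :|: CN \subset CM :|: CN', meq J (restrict sQ boxE),
        forall phi, phi \in atoms J ->
          phi \in atoms (union_model M N) \/ redundant (union_model M N) phi,
        freer (union_model M N) J &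
        (exists2 f : union_model M N -> J,
           is_hom f & forall y, exists x, f x = y)
        /\
        (exists rs : seq (duple (CM :|: CN)),
           meq J (foldr (fun r (K : model (CM :|: CN)) =>
                           crossing (val r.1) (val r.2) K)
                        (union_model M N) rs))].
Proof.
move=> N' CN' boxE; set B : model _ := boxE; set D := CM :&: CN.
have primedD c : c \in D -> primed CM prime c = prime c.
  by rewrite inE /primed => /andP[->].
have primedN c : c \notin CM -> primed CM prime c = c.
  by rewrite /primed => /negbTE->.
have new c : c \in D -> (prime c \notin CM) /\ (prime c \notin CN).
  by move/prime_new; rewrite inE negb_or => /andP.
have primed_notin c : c \in CN -> primed CM prime c \notin CM.
  have [cM cN|cM _] := boolP (c \in CM); last by rewrite primedN.
  by rewrite primedD ?inE ?cM //; case: (new c) => //; rewrite inE cM.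
have primed_inj : {in CN &, injective (primed CM prime)}.
  move=> x y xN yN; have [xM|xM] := boolP (x \in CM);
    have [yM|yM] := boolP (y \in CM); rewrite ?(primedN _ xM) ?(primedN _ yM) //.
  - by rewrite !primedD ?inE ?xM ?yM //; apply: prime_inj; rewrite inE ?xM ?yM.
  - have xD : x \in D by rewrite inE xM.
    by rewrite primedD // => xy; case: (new x xD); rewrite xy yN.
  - have yD : y \in D by rewrite inE yM.
    by rewrite primedD // => xy; case: (new y yD); rewrite -xy xN.
have dis : [disjoint CM & CN'].
  rewrite disjoint_subset; apply/subsetP => x xM; rewrite inE.
  by apply/negP => /imsetP[c /primed_notin + xE]; rewrite -xE xM.
have DC : D \subset CM :|: CN' by rewrite subIset // subsetUl.
have pDC : prime @: D \subset CM :|: CN'.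
  apply/subsetP => _ /imsetP[c cD ->]; rewrite inE -primedD // imset_f ?orbT //.
  by case/setIP: cD.
have sQ : CM :|: CN \subset CM :|: CN'.
  apply/subsetP => x; rewrite !inE; have [//|xM /= xN] := boolP (x \in CM).
  by rewrite -(primedN x xM) imset_f.
have atB phi : (phi \in atoms B) = (phi \in atoms (union_model M N')) &&
    [forall c in D, (c \in phi) == (prime c \in phi)].
  rewrite atoms_foldr_crossing_eq => [|c]; last first.
    by rewrite csE => cD; split; [apply: (subsetP DC) | apply: (subsetP pDC)];
      rewrite ?imset_f.
  congr andb; apply/allP/forall_inP => h c; first by rewrite -csE; apply: h.
  by rewrite csE; apply: h.
have constB (c d : cst (CM :|: CN')) :
    val c \in D -> val d = prime (val c) -> const B c = const B d.
  move=> cD dE; apply: const_eq => phi; rewrite atB => /andP[_].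
  by move=> /forall_inP/(_ _ cD)/eqP; rewrite dE.
(* Any free join [P] has the atoms of M + N', so [B] is also the quotient of [P] by the congruence
   defining the join model. *)
have freeB (P : model (CM :|: CN')) : is_free_join M N' P ->
    exists p : P -> B, [/\ is_hom p, forall c, p (const P c) = const B c,
      forall y, exists x, p x = y &
      forall x y, p x = p y <-> cong_closure (fun a b => exists c d,
        [/\ val c \in D, val d = prime (val c), a = const P c & b = const P d])
        x y].
  move=> /(free_join_atoms dis) atP.
  have [|p hp pc] := @freer_hom _ _ P B.
    by apply/freer_atoms/subsetP => phi; rewrite atB atP => /andP[].
  exists p; split=> //; first by apply: hom_onto => // c; exists (const P c).
  by move=> x y; apply: hom_cong_closure => // phi; rewrite atB atP.
split.
  (* Existence: [J] is the restriction of [B], whose inclusion [g] is bijective, and [q] is [p]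
     followed by the inverse of [g]. *)
  have PU := union_free_join M N' dis; have [p [hp pc sp kp]] := freeB _ PU.
  pose J := restrict sQ B; pose g : J -> B := @gval _ _ _ _ _.
  have hg : is_hom g by [].
  have gc (c : cst (CM :|: CN)) d : val c = val d -> g (const J c) = const B d.
    by move=> cd; rewrite /g /=; congr const; apply: val_inj.
  (* The only constants of [B] outside the restriction are the copies, equal in [B] to the
     originals. *)
  have sg : forall y, exists x, g x = y.
    apply: hom_onto => // d; have /setUP[dM|/imsetP[b bN dE]] := valP d.
      have dQ : val d \in CM :|: CN by rewrite inE dM.
      by exists (const J (Sub (val d) dQ)); apply: gc.
    have bQ : b \in CM :|: CN by rewrite inE bN orbT.
    exists (const J (Sub b bQ)); rewrite (gc _ (Sub b (subsetP sQ b bQ))) //.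
    have [bM|bM] := boolP (b \in CM).
      by apply: constB; rewrite /= ?inE ?bM // dE primedD // inE bM.
    by congr const; apply: val_inj; rewrite dE primedN.
  have exq x : exists j, g j == p x by have [j <-] := sg (p x); exists j.
  pose q x := xchoose (exq x).
  have gq x : g (q x) = p x by apply/eqP/(xchooseP (exq x)).
  have gI : injective g by apply: val_inj.
  clearbody q; exists J, (union_model M N') => //; exists q; split.
  - by move=> x y; apply: gI; rewrite hg !gq hp.
  - move=> y; have [x xy] := sp (g y); exists x; apply: gI.
    by rewrite gq xy.
  - move=> x y; apply: iff_trans (kp x y); rewrite -!gq.
    by split=> [->|/gI].
  by move=> c d cd; apply: gI; rewrite gq pc (gc d c).
move=> J [P PJ [q [hq sq kq cq]]].
have [p [hp pc sp kp]] := freeB P PJ.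
(* [J] and [B] are quotients of [P] with the same kernel. *)
have [x y|h [hh bh hqE]] := hom_iso hq hp sq sp.
  exact: iff_trans (kq x y) (iff_sym (kp x y)).
have hc c : h (const J c) = const B (cst_incl sQ c).
  by rewrite -(cq (cst_incl sQ c) c) // hqE pc.
have [[eM [heM keM _]] [eN [heN keN _]] _] := PJ.
(* [M] maps to [J] through [P], and [N] through N' and [P], both keeping names. *)
have UJ : freer (union_model M N) J.
  apply: union_freer => t s.
    apply: (@hom_const_le _ _ _ _ _ (q \o eM)) => [x y|c] /=.
      by rewrite heM hq.
    by rewrite (keM c (cst_incl (subsetUl _ _) c)) //; apply: cq.
  have [e he eE] := rename_hom N primed_inj.
  apply: (@hom_const_le _ _ _ _ _ (q \o eN \o e)) => [x y|c] /=.
    by rewrite he heN hq.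
  have cN' : primed CM prime (val c) \in CN' by rewrite imset_f // (valP c).
  pose c' : cst CN' := Sub (primed CM prime (val c)) cN'.
  rewrite (eE c c') // (keN c' (cst_incl (subsetUr CM CN') c')) //.
  have [cM|cM] := boolP (val c \in CM); last by apply: cq; rewrite /= primedN.
  have cD : val c \in D by rewrite inE cM (valP c).
  pose c0 : cst (CM :|: CN') := Sub (val c) (subsetP DC _ cD).
  (* A shared constant and its copy form a generating pair of the congruence, so [q] merges them. *)
  rewrite -(cq c0) //; apply/esym/kq => R _; apply.
  by exists c0, (cst_incl (subsetUr CM CN') c'); split; rewrite //= primedD.
split=> //.
- by exists h.
- exists sQ => -[t s]; rewrite /sat -(inj_hom_le _ _ hh (bij_inj bh)) /=.
  rewrite !(hom_nu _ _ hh) !(eq_nu hc).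
  by rewrite -[RHS]Order.le_val /= !gval_nu.
- by move=> phi pJ; left; apply: (subsetP (proj1 (freer_atoms _ _) UJ)).
split; last exact: freer_crossings.
have [f hf fc] := freer_hom UJ; exists f => //.
by apply: hom_onto => // c; exists (const (union_model M N) c).
Qed.
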